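(* Let $G$ be any connected graph and let $M$ be any nested set of bonds of $G$. Then the following are equivalent: (i) $M$ efficiently distinguishes all the edge-blocks of $G$, i.e. any two disjoint edge-blocks of $G$ are efficiently distinguished by some bond in $M$; (ii) for every $k\in\mathbb N$, the bonds in $M$ of size at most $k$ generate all the cuts of $G$ of size $k$.
   Context: Ends of $G$ are vertex-ends (equivalence classes of rays, two rays equivalent if no finite vertex set separates them); $\hat V(G):=V(G)\cup\Omega(G)$ where $\Omega(G)$ is the set of ends. A set $X\subseteq\hat V(G)$ lives in $C\subseteq V(G)$ if all vertices of $X$ lie in $C$ and every ray of every end in $X$ has a tail in $G[C]$. An edge set $F$ separates two elements of $\hat V(G)$ if they live in distinct components of $G-F$. For $k\in\mathbb N\cup\{\infty\}$, the $k$-edge-blocks of $G$ are the equivalence classes of the relation on $\hat V(G)$ ''cannot be separated by fewer than $k$ edges''; an edge-block is a $k$-edge-block for some $k$. An edge set $F$ distinguishes two edge-blocks if they live in distinct components of $G-F$, efficiently if no smaller edge set does. A cut-separation is a bipartition $\{A,B\}$ of $V(G)$ into nonempty sets; it corresponds to the cut $E(A,B)$ (in a connected graph each cut corresponds to a unique cut-separation). A bond is a cut both of whose sides induce connected subgraphs. Two cuts are nested if one has a side contained in a side of the other. A set $S$ of cut-separations generates a cut-separation $\{X,Y\}$ if there is a finite subset $\{\{A_\ell,B_\ell\}:\ell<n\}\subseteq S$ (with the labels $A_\ell,B_\ell$ of each element chosen suitably) such that $\{X,Y\}=\{\bigcup_{\ell<n}A_\ell,\ \bigcap_{\ell<n}B_\ell\}$;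 a set of cuts generates a cut if the corresponding cut-separations do.
   Formalization: ''Generates'' is read as finitely many iterated applications (with relabelling) of the stated union/intersection operation; with a single application (i)⇒(ii) fails, e.g. on the path a-b-c-d with its three one-edge bonds and the cut {ac, bd}. *)

(* Defs.v *)
From mathcomp Require Import all_boot.
From mathcomp Require Import boolp classical_sets functions cardinality.
From Stdlib Require Import Relation_Operators.

Set Implicit Arguments.
Unset Strict Implicit.
Unset Printing Implicit Defensive.

Local Open Scope classical_set_scope.
Local Open Scope card_scope.

(* Simple undirected graphs of arbitrary cardinality. *)
Record graph := Graph {
  vertex :> Type;
  adj : vertex -> vertex -> Prop;
  adj_sym : forall x y, adj x y -> adj y x;
  adj_irr : forall x, ~ adj x x
}.

Section Graphs.
Variable G : graph.

(* An edge is the two-element set of its endvertices. *)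
Definition edges : set (set G) :=
  [set e | exists x y, adj x y /\ e = [set x; y]].

(* The adjacency relations of G - F and of G[U]. *)
Definition del_edges (F : set (set G)) (x y : G) : Prop :=
  adj x y /\ ~ F [set x; y].

Definition induced (U : set G) (x y : G) : Prop := [/\ U x, U y & adj x y].

Definition component (U : set G) (e : G -> G -> Prop) (C : set G) : Prop :=
  exists2 x, U x & C = [set y | clos_refl_trans G e x y].

Definition component_del_edges (F : set (set G)) : set G -> Prop :=
  component setT (del_edges F).

Definition component_del_vertices (S : set G) : set G -> Prop :=
  component (~` S) (induced (~` S)).

Definition connected_in (U : set G) : Prop :=
  U !=set0 /\
  forall x y, U x -> U y -> clos_refl_trans G (induced U) x y.

Definition connected_graph : Prop := connected_in setT.

Definition ray (r : nat -> G) : Prop :=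
  injective r /\ forall n, adj (r n) (r n.+1).

Definition has_tail_in (r : nat -> G) (C : set G) : Prop :=
  exists n, forall m, n <= m -> C (r m).

Definition separates_rays (S : set G) (r s : nat -> G) : Prop :=
  exists C D, [/\ component_del_vertices S C, component_del_vertices S D,
    C <> D, has_tail_in r C & has_tail_in s D].

Definition ray_equiv (r s : nat -> G) : Prop :=
  forall S : set G, finite_set S -> ~ separates_rays S r s.

Definition is_end (w : set (nat -> G)) : Prop :=
  exists2 r, ray r & w = [set s | ray s /\ ray_equiv r s].

Definition graph_end : Type := {w : set (nat -> G) | is_end w}.

Definition Vhat : Type := (G + graph_end)%type.

Definition lives_in (X : set Vhat) (C : set G) : Prop :=
  (forall v, X (inl v) -> C v) /\
  (forall w : graph_end, X (inr w) ->
     forall r, proj1_sig w r -> has_tail_in r C).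

Definition distinguishes (F : set (set G)) (X Y : set Vhat) : Prop :=
  F `<=` edges /\
  exists C D, [/\ component_del_edges F C, component_del_edges F D,
    C <> D, lives_in X C & lives_in Y D].

Definition separates (F : set (set G)) (x y : Vhat) : Prop :=
  distinguishes F [set x] [set y].

(* Elements of N ∪ {∞} are encoded as [Some n] and [None]; having fewer than
   ∞ elements means being finite. *)
Definition fewer_than (F : set (set G)) (k : option nat) : Prop :=
  if k is Some n then exists2 m, m < n & F #= `I_m else finite_set F.

Definition inseparable (k : option nat) (x y : Vhat) : Prop :=
  forall F, fewer_than F k -> ~ separates F x y.

Definition k_edge_block (k : option nat) (X : set Vhat) : Prop :=
  exists x, X = [set y | inseparable k x y].

Definition edge_block (X : set Vhat) : Prop := exists k, k_edge_block k X.

Definition efficiently_distinguishes (F : set (set G)) (X Y : set Vhat) :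
    Prop :=
  distinguishes F X Y /\ forall F', distinguishes F' X Y -> F #<= F'.

(* An unordered bipartition {A, B} is handled through its two labellings
   (A, B) and (B, A). *)
Definition cut_separation (A B : set G) : Prop :=
  [/\ A !=set0, B !=set0, A `&` B = set0 & A `|` B = setT].

Definition edges_between (A B : set G) : set (set G) :=
  [set e | exists x y, [/\ A x, B y, adj x y & e = [set x; y]]].

Definition is_cut (c : set (set G)) : Prop :=
  exists A B, cut_separation A B /\ c = edges_between A B.

Definition is_bond (c : set (set G)) : Prop :=
  exists A B, [/\ cut_separation A B, c = edges_between A B,
    connected_in A & connected_in B].

Definition is_side (c : set (set G)) (A : set G) : Prop :=
  exists B, cut_separation A B /\ c = edges_between A B.

Definition nested_cuts (c d : set (set G)) : Prop :=
  exists A C, [/\ is_side c A, is_side d C & A `<=` C \/ C `<=` A].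

Definition nested_set (M : set (set (set G))) : Prop :=
  forall c d, M c -> M d -> nested_cuts c d.

(* Generation of cut-separations: the operation sending finitely many
   separations {A_l, B_l}, with a choice of labels, to the separation
   {\bigcup_l A_l, \bigcap_l B_l} may be iterated. A single application would
   not be enough: on the path a - b - c - d, the separation {ac, bd} is not of
   the form {\bigcup_l A_l, \bigcap_l B_l} for sides A_l, B_l of the
   three one-edge bonds, although these bonds distinguish all edge-blocks. *)
Inductive generated (S : set G -> set G -> Prop) : set G -> set G -> Prop :=
| gen_mem A B : S A B -> generated S A B
| gen_swap A B : generated S A B -> generated S B A
| gen_union n (A B : nat -> set G) :
    (forall l, l < n -> generated S (A l) (B l)) ->
    cut_separation (\bigcup_(l < n) A l) (\bigcap_(l < n) B l) ->
    generated S (\bigcup_(l < n) A l) (\bigcap_(l < n) B l).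

Definition separations_of (M : set (set (set G))) (A B : set G) : Prop :=
  cut_separation A B /\ M (edges_between A B).

Definition generates_cut (M : set (set (set G))) (c : set (set G)) : Prop :=
  exists X Y, [/\ cut_separation X Y, c = edges_between X Y &
    generated (separations_of M) X Y].

End Graphs.

(* Main.v *)
(* If each cut of a set has two given edge-blocks on the same side, then so has
   every cut that the set generates. Hence, if a minimal cut distinguishing two
   blocks is generated by bonds of at most its size, then one of these bonds
   already distinguishes them.

   Conversely, suppose that a side A of a cut of size k is not in the Boolean
   algebra generated by the sides of the bonds of size at most k in M. Then two
   ultrafilters on the vertex set, one containing A and one its complement,
   agree on this algebra. In a connected graph, the finite cuts are oriented by
   an ultrafilter towards a vertex or an end, which is found by descending in a
   spanning tree through subtrees that belong to the ultrafilter. The two points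
   obtained are separated by at most k edges, hence by a bond in M of size at
   most k, on whose sides the ultrafilters would have to disagree. *)

Require Import Defs.
From mathcomp Require Import all_boot.
From mathcomp Require Import boolp classical_sets functions cardinality filter.
From Stdlib Require Import Relation_Operators.

Local Open Scope classical_set_scope.
Local Open Scope card_scope.

(** * Finite sets and reachability *)

Lemma finite_bounded {T : Type} (A : set T) (f : T -> nat) :
  finite_set A -> exists b, forall x, A x -> f x <= b.
Proof.
move=> /(finite_image f) /finite_seqP[s sE].
exists (\max_(i <- s) i) => x Ax.
have : (f @` A) (f x) by exists x.
by rewrite sE /= => fxs; apply: (@leq_bigmax_seq _ s xpredT id).
Qed.

Lemma injective_avoids_finite {T : Type} (r : nat -> T) (S : set T) :
  injective r -> finite_set S -> exists n, forall m, n <= m -> ~ S (r m).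
Proof.
move=> injr finS.
have [|b bP] := @finite_bounded _ (r @^-1` S) id.
  by apply: finite_preimage => // x y _ _; exact: injr.
by exists b.+1 => m bm /bP; rewrite leqNgt bm.
Qed.

Lemma crt_sym {T : Type} (e : T -> T -> Prop) x y :
  (forall a b, e a b -> e b a) ->
  clos_refl_trans T e x y -> clos_refl_trans T e y x.
Proof.
move=> esym; elim=> [a b /esym|a|a b c _ ab _ bc]; first exact: rt_step.
  exact: rt_refl.
exact: rt_trans bc ab.
Qed.

Lemma crt_incl {T : Type} (e e' : T -> T -> Prop) x y :
  (forall a b, e a b -> e' a b) ->
  clos_refl_trans T e x y -> clos_refl_trans T e' x y.
Proof.
move=> ee'; elim=> [a b /ee'|a|a b c _ ab _ bc]; first exact: rt_step.
  exact: rt_refl.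
exact: rt_trans ab bc.
Qed.

Lemma crt_closed {T : Type} (e : T -> T -> Prop) (A : set T) x y :
  (forall a b, A a -> e a b -> A b) ->
  clos_refl_trans T e x y -> A x -> A y.
Proof.
move=> eA; elim=> // [a b|a b c _ ab _ bc /ab //].
by move=> /[swap]; exact: eA.
Qed.

Lemma crt_path {T : Type} (e : T -> T -> Prop) (r : nat -> T) n m :
  (forall i, n <= i -> e (r i) (r i.+1)) -> n <= m ->
  clos_refl_trans T e (r n) (r m).
Proof.
move=> er; elim: m => [|m IH]; first by rewrite leqn0 => /eqP->; exact: rt_refl.
rewrite leq_eqVlt => /predU1P[->|nm]; first exact: rt_refl.
by apply: rt_trans (IH nm) _; apply: rt_step; exact: er.
Qed.

(** * Components after edge deletion *)

Lemma del_edges_sym {G : graph} (F : set (set G)) a b :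
  del_edges F a b -> del_edges F b a.
Proof. by move=> [ab nF]; split; [exact: adj_sym|rewrite setUC]. Qed.

Lemma component_eq {G : graph} (U : set G) (e : G -> G -> Prop) C D x :
  (forall a b, e a b -> e b a) ->
  component U e C -> component U e D -> C x -> D x -> C = D.
Proof.
move=> sym [c _ ->] [d _ ->] /= cx dx.
apply/seteqP; split=> y /= ay.
  exact: rt_trans dx (rt_trans _ _ _ _ _ (crt_sym _ _ _ sym cx) ay).
exact: rt_trans cx (rt_trans _ _ _ _ _ (crt_sym _ _ _ sym dx) ay).
Qed.

Lemma component_closed {G : graph} (F : set (set G)) C x y :
  component_del_edges F C -> C x -> del_edges F x y -> C y.
Proof.
by move=> [c _ ->] /= cx xy; apply: rt_trans cx (rt_step _ _ _ _ xy).
Qed.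

Lemma component_nonempty {G : graph} (F : set (set G)) C :
  component_del_edges F C -> C !=set0.
Proof. by move=> [c _ ->]; exists c; exact: rt_refl. Qed.

Lemma component_exists {G : graph} (F : set (set G)) x :
  exists2 C, component_del_edges F C & C x.
Proof.
by exists [set y | clos_refl_trans G (del_edges F) x y];
  [exists x|exact: rt_refl].
Qed.

(** * Where vertices and ends live *)

Definition endvertices {G : graph} (F : set (set G)) : set G :=
  \bigcup_(e in F) e.

Lemma endvertices_finite {G : graph} (F : set (set G)) :
  F `<=` @edges G -> finite_set F -> finite_set (endvertices F).
Proof.
move=> Fe finF; apply: bigcup_finite => // e /Fe [x [y [_ ->]]].
exact: finite_set2.
Qed.

Lemma del_edges_avoid {G : graph} (F : set (set G)) x y :
  adj x y -> ~ endvertices F x -> del_edges F x y.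
Proof.
by move=> xy nx; split=> // Fxy; apply: nx; exists [set x; y] => //; left.
Qed.

Lemma induced_sym {G : graph} (U : set G) a b :
  induced U a b -> induced U b a.
Proof. by move=> [Ua Ub /adj_sym]. Qed.

Lemma ray_equiv_refl {G : graph} (r : nat -> G) : ray_equiv r r.
Proof.
move=> S _ [C [D [Cc Dc CD [n nC] [m mD]]]]; apply: CD.
apply: (component_eq _ _ _ _ (r (maxn n m)) (induced_sym (~` S)) Cc Dc).
  exact/nC/leq_maxl.
exact/mD/leq_maxr.
Qed.

(** Being injective, the ray meets the finitely many endvertices of [F] only finitely often; the
    tail beyond them uses no edge of [F]. *)
Lemma ray_lives {G : graph} (F : set (set G)) (r : nat -> G) :
  F `<=` @edges G -> finite_set F -> ray r ->
  exists2 C, component_del_edges F C & has_tail_in r C.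
Proof.
move=> Fe finF [injr adjr].
have [n nS] := injective_avoids_finite r _ injr (endvertices_finite F Fe finF).
have [C Cc Cn] := component_exists F (r n).
exists C => //; exists n => m nm.
apply: (crt_closed (del_edges F) C (r n) (r m)) => //.
  by move=> a b Ca; apply: component_closed Cc Ca.
by apply: crt_path nm => i ni; apply: del_edges_avoid (adjr i) (nS i ni).
Qed.

(** If two rays of the end had tails in distinct components of [G - F], the finite set of
    endvertices of [F] would separate them, since walks avoiding these vertices avoid [F]. *)
Lemma end_lives {G : graph} (F : set (set G)) (w : graph_end G) :
  F `<=` @edges G -> finite_set F ->
  exists2 C, component_del_edges F C & lives_in [set inr w] C.
Proof.
move=> Fe finF; case: w => w wE; have [r rr wE'] := wE.
have [C Cc [n nC]] := ray_lives F r Fe finF rr.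
exists C => //; split=> // _ [->] s /=; rewrite wE' /= => -[rs rsE].
have [D Dc [m mD]] := ray_lives F s Fe finF rs.
suff -> : C = D by exists m.
have finS := endvertices_finite F Fe finF.
have [n' n'S] := injective_avoids_finite r _ (proj1 rr) finS.
have [m' m'S] := injective_avoids_finite s _ (proj1 rs) finS.
apply: contrapT => CD; apply: (rsE _ finS).
have tail (t : nat -> G) k : ray t ->
    (forall i, k <= i -> ~ endvertices F (t i)) -> forall i, k <= i ->
    clos_refl_trans G (induced (~` endvertices F)) (t k) (t i).
  move=> [_ adjt] tk i ki; apply: crt_path ki => j kj.
  by split=> //; apply: tk => //; exact: leqW.
exists [set y | clos_refl_trans G (induced (~` endvertices F)) (r n') y],
  [set y | clos_refl_trans G (induced (~` endvertices F)) (s m') y]; split.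
- by exists (r n') => //; exact: n'S.
- by exists (s m') => //; exact: m'S.
- move=> E.
  (* Past [m'] the ray [s] avoids the endvertices of [F]; past [m] it lies in [D]. *)
  pose k := maxn m m'.
  have rs' : clos_refl_trans G (induced (~` endvertices F)) (r n') (s k).
    move/seteqP: E => [_]; apply; apply: tail => //; exact: leq_maxr.
  have rr' := tail r _ rr n'S _ (leq_maxr n n').
  have: clos_refl_trans G (del_edges F) (r (maxn n n')) (s k).
    apply: crt_incl (rt_trans _ _ _ _ _ (crt_sym _ _ _ _ rr') rs').
      by move=> a b [Sa _ ab]; exact: del_edges_avoid.
    exact: induced_sym.
  move=> rk; apply: CD.
  apply: (component_eq _ _ _ _ (s k) (del_edges_sym F) Cc Dc);
    last by apply: mD; exact: leq_maxl.
  apply: (crt_closed _ C _ _ _ rk); last by apply: nC; exact: leq_maxl.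
  by move=> a b Ca; apply: component_closed Cc Ca.
- by exists n'; apply: tail.
- by exists m'; apply: tail.
Qed.

Lemma point_lives {G : graph} (F : set (set G)) (x : Vhat G) :
  F `<=` @edges G -> finite_set F ->
  exists2 C, component_del_edges F C & lives_in [set x] C.
Proof.
case: x => [v|w]; last exact: end_lives.
move=> _ _; have [C Cc Cv] := component_exists F v.
by exists C => //; split=> // _ [->].
Qed.

Lemma lives_in_meet {G : graph} (x : Vhat G) (C D : set G) :
  lives_in [set x] C -> lives_in [set x] D -> C `&` D !=set0.
Proof.
case: x => [v|[w [r rr wE]]] [Cv Cw] [Dv Dw].
  by exists v; split; [exact: Cv|exact: Dv].
have wr : w r by rewrite wE /=; split=> //; exact: ray_equiv_refl.
set w' := exist _ _ _ in Cw Dw.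
have [n nC] := Cw w' erefl r wr; have [m mD] := Dw w' erefl r wr.
exists (r (maxn n m)).
by split; [exact/nC/leq_maxl|exact/mD/leq_maxr].
Qed.

Lemma lives_in_sub {G : graph} (X : set (Vhat G)) (C D : set G) :
  C `<=` D -> lives_in X C -> lives_in X D.
Proof.
move=> CD [Xv Xw]; split=> [v /Xv/CD //|w /Xw wC r /wC [n nC]].
by exists n => m /nC/CD.
Qed.

Lemma lives_in_set1 {G : graph} (X : set (Vhat G)) (x : Vhat G) (C : set G) :
  X x -> lives_in X C -> lives_in [set x] C.
Proof.
move=> Xx [Xv Xw].
by split=> [v vx|w wx]; [apply: Xv; rewrite vx|apply: Xw; rewrite wx].
Qed.

Lemma lives_in_pointwise {G : graph} (X : set (Vhat G)) (C : set G) :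
  (forall x, X x -> lives_in [set x] C) -> lives_in X C.
Proof. by move=> XC; split=> [v|w] /XC [Cv Cw]; [exact: Cv|exact: Cw]. Qed.

(** * Cuts and their sides *)

Lemma edges_between_sub {G : graph} (A B : set G) :
  edges_between A B `<=` @edges G.
Proof. by move=> _ [x [y [_ _ xy ->]]]; exists x, y. Qed.

Lemma edges_betweenC {G : graph} (A B : set G) :
  edges_between A B = edges_between B A.
Proof.
by apply/seteqP; split=> _ [x [y [Ax By xy ->]]]; exists y, x; rewrite setUC;
  split=> //; exact: adj_sym.
Qed.

Lemma cut_separationC {G : graph} (A B : set G) :
  cut_separation A B -> cut_separation B A.
Proof. by move=> [A0 B0 AB AUB]; split; rewrite // 1?setIC 1?setUC. Qed.

Lemma cut_separation_compl {G : graph} (A B : set G) :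
  cut_separation A B -> B = ~` A.
Proof.
move=> [_ _ AB AUB]; apply/seteqP; split=> x.
  by move=> Bx Ax; rewrite -[False]/(@set0 G x) -AB.
move=> nA; have : (A `|` B) x by rewrite AUB.
by case.
Qed.

Lemma cut_separationP {G : graph} (A : set G) :
  A !=set0 -> A <> setT -> cut_separation A (~` A).
Proof.
move=> A0 AT; split=> //; rewrite ?setICr ?setUCr //.
by apply/set0P/negP => /eqP A0'; apply: AT; rewrite -[A]setCK A0' setC0.
Qed.

(** Every edge leaving [A] belongs to the cut, so no walk in the remaining graph leaves [A]. *)
Lemma component_sub_side {G : graph} (A B C : set G) (x : G) :
  cut_separation A B -> component_del_edges (edges_between A B) C ->
  C x -> A x -> C `<=` A.
Proof.
move=> AB Cc Cx Ax y Cy; move: Cc Cx Cy => [c _ ->] /= cx cy.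
have xy := rt_trans _ _ _ _ _ (crt_sym _ _ _ (del_edges_sym _) cx) cy.
apply: (crt_closed _ A _ _ _ xy) => // a b Aa [ab nab].
apply: contrapT => nAb; apply: nab; exists a, b; split=> //.
by rewrite (cut_separation_compl A B).
Qed.

Lemma component_side {G : graph} (A B C : set G) :
  cut_separation A B -> component_del_edges (edges_between A B) C ->
  C `<=` A \/ C `<=` B.
Proof.
move=> AB Cc; have [x Cx] := component_nonempty _ _ Cc.
have : (A `|` B) x by have [_ _ _ ->] := AB.
case=> [Ax|Bx]; [left|right]; first exact: (component_sub_side A B C x).
apply: (component_sub_side B A C x) => //; first exact: cut_separationC.
by rewrite edges_betweenC.
Qed.

(** * From ultrafilters to vertices or ends *)

Fixpoint walk {G : graph} (v0 : G) (n : nat) : set G :=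
  if n is n'.+1 then [set v | exists2 u, walk v0 n' u & adj u v]
  else [set v0].

(** A breadth-first tree: [dep] is the distance from [v0], and [par v] is the last vertex before [v]
    on a shortest walk. *)
Lemma spanning_tree {G : graph} (v0 : G) : connected_graph G ->
  exists (par : G -> G) (dep : G -> nat), [/\ par v0 = v0, dep v0 = 0 &
    forall v, v <> v0 -> adj (par v) v /\ dep v = (dep (par v)).+1].
Proof.
move=> [_ conn].
have reach v : exists n, `[< walk v0 n v >].
  have : clos_refl_trans G (induced setT) v0 v by exact: conn.
  move=> /(crt_closed _ (fun v => exists n, `[< walk v0 n v >])); apply.
    move=> a b [n /asboolP an] [_ _ ab].
    by exists n.+1; apply/asboolP; exists a.
  by exists 0; apply/asboolP.
pose dep v := ex_minn (reach v).
have dep_walk v : walk v0 (dep v) v.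
  by rewrite /dep; case: ex_minnP => n /asboolP.
have dep_le n v : walk v0 n v -> dep v <= n.
  by move=> wn; rewrite /dep; case: ex_minnP => m _; apply; apply/asboolP.
have dep0 : dep v0 = 0 by apply/eqP; rewrite -leqn0; exact: dep_le.
have parP v : exists u, (v = v0 -> u = v0) /\
    (v <> v0 -> adj u v /\ dep v = (dep u).+1).
  have [->|vv0] := pselect (v = v0); first by exists v0.
  have := dep_walk v; case dv: (dep v) => [|n] /=; first by [].
  move=> [u wu uv]; exists u; split=> // _; split=> //.
  congr _.+1; apply/eqP; rewrite eqn_leq dep_le // andbT.
  by rewrite -ltnS -dv; apply: dep_le => /=; exists u.
have [par parE] := choice parP.
exists par, dep; split=> // [|v /(proj2 (parE v)) //].
exact: (proj1 (parE v0)).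
Qed.

Lemma ultra_bigcup {I T : Type} (p : set_system T) (D : set I)
    (f : I -> set T) :
  UltraFilter p -> finite_set D -> p (\bigcup_(i in D) f i) ->
  exists2 i, D i & p (f i).
Proof.
move=> up /(@finite_fsetP {classic I})[X DE] pU; apply: contrapT => nex.
have pC : p (\bigcap_(i in D) ~` f i).
  rewrite DE; apply: (@filter_bigI _ {classic I}) => i iX.
  have [pf|//] := in_ultra_setVsetC (f i) up.
  by case: nex; exists i => //; rewrite DE.
apply: (filter_not_empty p).
by rewrite -(setICr (\bigcup_(i in D) f i)) setC_bigcup; exact: filterI.
Qed.

(** Descend from the root through subtrees in [p]. If no child of [v] has its subtree in [p], then
    [v] is the point; if the descent never stops, it traces a ray, whose end is the point. *)
Lemma ultrafilter_point {G : graph} (p : set_system G) :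
  connected_graph G -> UltraFilter p ->
  exists x : Vhat G, forall Z, p Z -> finite_set (edges_between Z (~` Z)) ->
    lives_in [set x] Z.
Proof.
move=> hG up; have [[v0 _] _] := hG.
have [par [dep [par0 dep0 parE]]] := spanning_tree v0 hG.
pose T v : set G := [set u | exists j, iter j par u = v].
have T_refl v : T v v by exists 0.
have T_trans u v w : T v u -> T w v -> T w u.
  by move=> [i <-] [j <-]; exists (j + i); rewrite iterD.
(* The root is its own parent; [c <> v] keeps it from counting as its own child. *)
have T_child v u : T v u -> u <> v -> exists c, [/\ par c = v, c <> v & T c u].
  move=> [j]; elim: j u => [//|j IH] u; rewrite iterSr => ju uv.
  have [puv|puv] := pselect (par u = v); first by exists u.
  have [c [pc cv Tc]] := IH _ ju puv; exists c; split=> //.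
  by apply: T_trans Tc; exists 1.
have T_root u : T v0 u.
  have [n] := ubnP (dep u); elim: n u => // n IH u du.
  have [->//|uv0] := pselect (u = v0).
  have [_ dE] := parE u uv0.
  by apply: T_trans (IH (par u) _); [exists 1|rewrite -ltnS -dE].
have dep_T v u : T v u -> dep v <= dep u.
  move=> [j]; elim: j u => [u <-//|j IH u]; rewrite iterSr => /IH.
  have [->|/parE[_ ->] /leqW//] := pselect (u = v0).
  by rewrite par0.
have child_v0 v c : par c = v -> c <> v -> c <> v0.
  by move=> pc cv cv0; apply: cv; rewrite -pc cv0 par0.
have p0 : p (T v0).
  by apply: filterS filterT => u _; exact: T_root.
pose W Z : set G := [set w | Z w /\ ~ Z (par w)].
(* The tree edge from a vertex of [W Z] to its parent crosses the finite cut. *)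
have W_finite Z : finite_set (edges_between Z (~` Z)) -> finite_set (W Z).
  move=> finZ; apply: sub_finite_set
    (endvertices_finite _ (edges_between_sub Z (~` Z)) finZ) => w [Zw nZp].
  have /parE[pw _] : w <> v0 by move=> w0; apply: nZp; rewrite w0 par0 -w0.
  exists [set w; par w]; last by left.
  by exists w, (par w); split=> //; exact: adj_sym.
(* From a vertex of [Z] in the subtree [T v], climbing towards [v] leaves [Z]
   at one of the finitely many vertices in [W Z]; their subtrees cover
   [Z `&` T v], so one of them belongs to [p]. *)
have key Z v : p Z -> finite_set (edges_between Z (~` Z)) -> p (T v) ->
    ~ Z v -> exists2 w, W Z w & [/\ T v w, w <> v & p (T w)].
  move=> pZ /W_finite finW pTv nZv.
  have [||w [Ww [Tw wv]] pw] :=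
      @ultra_bigcup _ _ p (W Z `&` [set w | T v w /\ w <> v]) T up.
  - by apply: sub_finite_set finW => w [].
  - apply: filterS (filterI pZ pTv) => u [+ [j]].
    elim: j u => [u Zu /= uv|j IH u Zu]; first by rewrite uv in Zu.
    rewrite iterSr => ju; have [Zp|nZp] := pselect (Z (par u)).
      have [w Ww Tw] := IH _ Zp ju; exists w => //.
      by apply: T_trans Tw; exists 1.
    exists u => //; split=> //; split; last by move=> uv; rewrite uv in Zu.
    by exists j.+1; rewrite iterSr.
  by exists w.
have [[v [pTv nochild]]|next] := pselect (exists v, p (T v) /\
    forall c, par c = v -> c <> v -> ~ p (T c)).
  (* If [v] were outside [Z], [key] would put the subtree of a proper descendant into [p], and with
     it the subtree of a child of [v]. *)
  exists (inl v) => Z pZ finZ; split=> // _ [->]; apply: contrapT => nZv.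
  have [w _ [Tw wv pTw]] := key Z v pZ finZ pTv nZv.
  have [c [pc cv Tc]] := T_child v w Tw wv.
  apply: (nochild c pc cv); apply: filterS pTw => u uw.
  exact: T_trans uw Tc.
have nextP v : exists c, p (T v) -> [/\ par c = v, c <> v & p (T c)].
  have [pTv|] := pselect (p (T v)); last by exists v.
  apply: contrapT => nc; apply: next; exists v; split=> // c pc cv pTc.
  by apply: nc; exists c.
have [f fP] := choice nextP.
pose r n := iter n f v0.
have rT n : p (T (r n)).
  by elim: n => [//|n /fP[_ _]].
have rP n : par (r n.+1) = r n /\ r n.+1 <> v0.
  by have [pc cv _] := fP _ (rT n); split=> //; exact: child_v0 cv.
have r_dep n : dep (r n) = n.
  elim: n => [//|n IH]; have [pr r0] := rP n.
  by have [_ ->] := parE _ r0; rewrite pr IH.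
have ray_r : ray r.
  split=> [m n mn|n]; first by rewrite -(r_dep m) mn r_dep.
  by have [pr r0] := rP n; have [] := parE _ r0; rewrite pr.
have r_end : is_end [set s | ray s /\ ray_equiv r s] by exists r.
exists (inr (exist _ _ r_end)) => Z pZ finZ.
have [b bP] := finite_bounded _ dep (W_finite Z finZ).
(* Were [r n] outside [Z], [key] would give a vertex of [W Z] properly below it, hence of depth
   greater than [b]. *)
have tailZ n : b <= n -> Z (r n).
  move=> bn; apply: contrapT => nZ.
  have [w /bP wb [Tw wr _]] := key Z (r n) pZ finZ (rT n) nZ.
  have [c [pc cr /dep_T]] := T_child _ _ Tw wr.
  have [_ ->] := parE _ (child_v0 _ _ pc cr).
  rewrite pc r_dep => nw.
  by move: (leq_trans nw (leq_trans wb bn)); rewrite ltnn.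
have [C Cc Cw] := end_lives _ (exist _ _ r_end) (edges_between_sub _ _) finZ.
(* The end lives in the component [C], which meets [Z] on the ray and so cannot cross the cut. *)
suff CZ : C `<=` Z by exact: lives_in_sub CZ Cw.
have [n nC] : has_tail_in r C.
  by apply: (proj2 Cw _ erefl) => /=; split=> //; exact: ray_equiv_refl.
have Zr := tailZ _ (leq_maxl b n); have Cr := nC _ (leq_maxr b n).
have [ZT|ZT] := pselect (Z = setT); first by rewrite ZT.
apply: (component_sub_side _ _ _ _ _ Cc Cr Zr).
by apply: cut_separationP => //; exists (r (maxn b n)).
Qed.

(** * Edge-blocks under small edge sets *)

Lemma fewer_than_finite {G : graph} (F : set (set G)) k :
  fewer_than F k -> finite_set F.
Proof. by case: k => //= n [m _ Fm]; exists m. Qed.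

Lemma fewer_than_card_le {G : graph} (F F' : set (set G)) k :
  F' #<= F -> fewer_than F k -> fewer_than F' k.
Proof.
case: k => /= [n FF' [m mn Fm]|]; last exact: card_le_finite.
have [m' F'm'] : finite_set F' by apply: card_le_finite FF' _; exists m.
exists m' => //; apply: leq_ltn_trans mn.
by rewrite -card_le_II -(card_le_eql F'm') -(card_le_eqr Fm).
Qed.

(** Allows the indices of two blocks to be compared, with [None] as the largest. *)
Lemma fewer_than_total {G : graph} k l :
  (forall F : set (set G), fewer_than F k -> fewer_than F l) \/
  (forall F : set (set G), fewer_than F l -> fewer_than F k).
Proof.
case: k l => [k|] [l|]; [|left|right|by left]; last 2 first.
- by move=> F /fewer_than_finite.
- by move=> F /fewer_than_finite.
by have [kl|/ltnW lk] := leqP k l; [left|right] => F [m mk Fm]; exists m => //;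
  apply: leq_trans mk _.
Qed.

Lemma distinguishes_sym {G : graph} (F : set (set G)) X Y :
  distinguishes F X Y -> distinguishes F Y X.
Proof.
move=> [Fe [C [D [Cc Dc CD XC YD]]]].
by split=> //; exists D, C; split=> // /esym.
Qed.

Lemma efficiently_distinguishes_sym {G : graph} (F : set (set G)) X Y :
  efficiently_distinguishes F X Y -> efficiently_distinguishes F Y X.
Proof.
move=> [FXY eff]; split; first exact: distinguishes_sym.
by move=> F' /distinguishes_sym/eff.
Qed.

Lemma lives_in_component_eq {G : graph} (F : set (set G)) C D x :
  component_del_edges F C -> component_del_edges F D ->
  lives_in [set x] C -> lives_in [set x] D -> C = D.
Proof.
move=> Cc Dc xC xD; have [v [Cv Dv]] := lives_in_meet _ _ _ xC xD.
exact: (component_eq _ _ _ _ _ (del_edges_sym F) Cc Dc Cv Dv).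
Qed.

Lemma inseparable_refl {G : graph} k (x : Vhat G) : inseparable k x x.
Proof.
move=> F _ [_ [C [D [Cc Dc CD xC xD]]]]; apply: CD.
exact: lives_in_component_eq Cc Dc xC xD.
Qed.

(** A point of the block living in another component would be separated from [x] by [F]. *)
Lemma block_lives {G : graph} (F : set (set G)) k (x : Vhat G) C :
  F `<=` @edges G -> fewer_than F k -> component_del_edges F C ->
  lives_in [set x] C -> lives_in [set y | inseparable k x y] C.
Proof.
move=> Fe Fk Cc xC; apply: lives_in_pointwise => y /= xy.
have [D Dc yD] := point_lives F y Fe (fewer_than_finite _ _ Fk).
have [<-//|DC] := pselect (D = C); case: (xy F Fk); split=> //.
by exists C, D; split=> // /esym.
Qed.

(** * Sides of bonds *)

Lemma connected_side_component {G : graph} (A B : set G) :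
  cut_separation A B -> connected_in A ->
  component_del_edges (edges_between A B) A.
Proof.
move=> AB [[a Aa] conn]; exists a => //; apply/seteqP; split=> x.
  move=> Ax; apply: crt_incl (conn a x Aa Ax) => u v [Au Av uv]; split=> //.
  move=> [s [t [As Bt _ /seteqP[_ /(_ t (or_intror erefl))]]]].
  move: Bt; rewrite (cut_separation_compl A B AB) => nAt.
  by case=> /= E; apply: nAt; rewrite E.
apply: (component_sub_side A B _ a AB) => //; first by exists a.
exact: rt_refl.
Qed.

Lemma edges_between_pair {G : graph} (A : set G) u v : adj u v ->
  edges_between A (~` A) [set u; v] <-> ~ (A u <-> A v).
Proof.
move=> uv; split=> [[x [y [Ax nAy _ E]]] [Auv Avu]|nAuv].
  have xuv : [set u; v] x by rewrite E; left.
  have yuv : [set u; v] y by rewrite E; right.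
  by apply: nAy; case: xuv yuv => /= ? [] /= ?; subst x y; auto.
have [Au|nAu] := pselect (A u).
  by exists u, v; split=> // Av; apply: nAuv.
exists v, u; split=> //; last by rewrite setUC.
  by apply: contrapT => nAv; apply: nAuv.
exact: adj_sym.
Qed.

(** Along every edge, membership in [A] changes exactly when membership in [U] does. By
    connectedness the two sets agree everywhere or nowhere. *)
Lemma cut_sides_unique {G : graph} (A B U V : set G) : connected_graph G ->
  cut_separation A B -> cut_separation U V ->
  edges_between A B = edges_between U V -> U = A \/ U = B.
Proof.
move=> [[v0 _] conn] AB UV.
rewrite (cut_separation_compl A B AB) (cut_separation_compl U V UV) => E.
have step a b : adj a b -> ((A a <-> U a) <-> (A b <-> U b)).
  move=> ab; have := edges_between_pair A a b ab.
  have := edges_between_pair U a b ab; rewrite E.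
  have [?|?] := pselect (A a); have [?|?] := pselect (A b);
    have [?|?] := pselect (U a); have [?|?] := pselect (U b); tauto.
have all v : (A v <-> U v) <-> (A v0 <-> U v0).
  have : clos_refl_trans G (induced setT) v0 v by exact: conn.
  move=> /(crt_closed _ [set w | (A w <-> U w) <-> (A v0 <-> U v0)]).
  apply=> //.
  by move=> a b /= aE [_ _ /step sab]; apply: iff_trans aE; exact: iff_sym.
have [AU0|nAU0] := pselect (A v0 <-> U v0); [left|right];
  apply/seteqP; split=> v.
- by have [_ /(_ AU0)[]] := all v.
- by have [_ /(_ AU0)[]] := all v.
- by have [? ?] := all v => Uv /= Av; apply: nAU0; tauto.
- have [? ?] := all v; rewrite /= => nAv; apply: contrapT => nUv.
  by apply: nAU0; tauto.
Qed.

Lemma bond_side_component {G : graph} (A B : set G) : connected_graph G ->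
  is_bond (edges_between A B) -> cut_separation A B ->
  component_del_edges (edges_between A B) A.
Proof.
move=> hG [A' [B' [AB' E cA cB]]] AB; rewrite E.
have [->|->] := cut_sides_unique A' B' A B hG AB' AB (esym E).
  exact: connected_side_component.
by rewrite edges_betweenC; apply: connected_side_component => //;
  exact: cut_separationC.
Qed.

(** Deleting a bond leaves exactly two components, namely its sides. *)
Lemma bond_distinguishes {G : graph} (A B : set G) (X Y : set (Vhat G)) :
  connected_graph G -> is_bond (edges_between A B) -> cut_separation A B ->
  distinguishes (edges_between A B) X Y <->
  lives_in X A /\ lives_in Y B \/ lives_in X B /\ lives_in Y A.
Proof.
move=> hG bond AB; have Ac := bond_side_component A B hG bond AB.
have Bc : component_del_edges (edges_between A B) B.
  by rewrite edges_betweenC; apply: bond_side_component => //;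
    [rewrite edges_betweenC|exact: cut_separationC].
have nAB : A <> B.
  move=> AeB; have [[x Ax] _ /seteqP[AB0 _] _] := AB.
  by apply: (AB0 x); rewrite -AeB.
split=> [[_ [C [D [Cc Dc CD XC YD]]]]|sides].
  have side E : component_del_edges (edges_between A B) E -> E = A \/ E = B.
    move=> Ec; have [v Ev] := component_nonempty _ _ Ec.
    have : (A `|` B) v by have [_ _ _ ->] := AB.
    by case=> [Av|Bv]; [left|right];
      apply: (component_eq _ _ _ _ v (del_edges_sym _) Ec).
  have [CE|CE] := side C Cc; have [DE|DE] := side D Dc; subst C D.
  - by [].
  - by left.
  - by right.
  - by [].
split; first exact: edges_between_sub.
by case: sides => -[XC YD]; [exists A, B|exists B, A]; split=> // /esym.
Qed.

(** * The Boolean algebra of a set of separations, and its ultrafilters *)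

(* The Boolean algebra of vertex sets generated by [S]: [generated] misses the
   two sets that are not sides of a cut-separation. *)
Definition algebra {G : graph} (S : set G -> set G -> Prop) (Z : set G) :=
  [\/ Z = set0, Z = setT | generated S Z (~` Z)].

Lemma algebraC {G : graph} (S : set G -> set G -> Prop) Z :
  algebra S Z -> algebra S (~` Z).
Proof.
case=> [->|->|gZ]; first by apply: Or32; rewrite setC0.
  by apply: Or31; rewrite setCT.
by apply: Or33; rewrite setCK; exact: gen_swap.
Qed.

Lemma algebraU {G : graph} (S : set G -> set G -> Prop) Z1 Z2 :
  algebra S Z1 -> algebra S Z2 -> algebra S (Z1 `|` Z2).
Proof.
case=> [->|->|g1]; first by rewrite set0U.
  by move=> _; apply: Or32; rewrite setTU.
case=> [->|->|g2]; first by rewrite setU0; apply: Or33.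
  by apply: Or32; rewrite setUT.
(* [gen_union] only yields separations with nonempty sides, so trivial unions are split off. *)
have [U0|/eqP/set0P U0] := pselect (Z1 `|` Z2 = set0); first exact: Or31.
have [UT|UT] := pselect (Z1 `|` Z2 = setT); first exact: Or32.
apply: Or33.
pose A l := if l is 0 then Z1 else Z2.
have AE : Z1 `|` Z2 = \bigcup_(l < 2) A l.
  apply/seteqP; split=> x; first by case=> Zx; [exists 0|exists 1].
  by case=> -[|l] _ Zx; [left|right].
have BE : ~` (Z1 `|` Z2) = \bigcap_(l < 2) ~` A l by rewrite AE setC_bigcup.
rewrite BE AE; apply: gen_union => [[|[|]]//|].
rewrite -BE -AE; exact: cut_separationP.
Qed.

Lemma algebraI {G : graph} (S : set G -> set G -> Prop) Z1 Z2 :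
  algebra S Z1 -> algebra S Z2 -> algebra S (Z1 `&` Z2).
Proof.
move=> /algebraC g1 /algebraC g2.
by rewrite -[_ `&` _]setCK setCI; apply: algebraC; exact: algebraU.
Qed.

(** [within A F] is the filter generated by [F] and [A]; it is proper because no member of [F]
    misses [A]. *)
Lemma ultrafilter_meet {T : Type} (F : set_system T) (A : set T) :
  Filter F -> (forall Z, F Z -> Z `&` A !=set0) ->
  exists2 p, UltraFilter p & F `<=` p /\ p A.
Proof.
move=> FF FA.
have FP : ProperFilter (within A F).
  apply: Build_ProperFilter => F0; have [x [nAx Ax]] := FA _ F0.
  exact: nAx.
have [p [up Fp]] := ultraFilterLemma FP; exists p => //; split.
  move=> Z FZ; apply: Fp; rewrite /within /=; apply: filterS FZ => x Zx _.
  exact: Zx.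
by apply: Fp; rewrite /within /=; apply: filterS (filterT : F setT) => x _.
Qed.

(* The sets [Z] of the algebra with [Z `&` A] in the algebra form a proper
   ideal. An ultrafilter avoiding it meets both [A] and its complement in
   each of its members from the algebra. *)
Lemma ultrafilters_agree {G : graph} (S : set G -> set G -> Prop) (A : set G) :
  ~ algebra S A ->
  exists p q, [/\ UltraFilter p, UltraFilter q, p A, q (~` A) &
    forall Z, algebra S Z -> p Z -> q Z].
Proof.
move=> nA.
(* The filter dual to the ideal. Were it improper, the whole vertex set would lie in the ideal and
   [A] in the algebra. *)
pose F0 : set_system G := [set U | exists Z,
  [/\ algebra S Z, algebra S (Z `&` A) & ~` Z `<=` U]].
have F0P : ProperFilter F0.
  split.
    move=> [Z [_ ZA Z0]]; apply: nA; rewrite -[A]setTI.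
    suff <- : Z = setT by [].
    by apply/seteqP; split=> // x _; apply: contrapT => /Z0.
  split.
  - by exists set0; rewrite set0I; split=> //; exact: Or31.
  - move=> U V [Z [gZ gZA ZU]] [Z' [gZ' gZA' ZV]]; exists (Z `|` Z').
    split; first exact: algebraU.
      by rewrite setIUl; exact: algebraU.
    by rewrite setCU => x [/ZU Ux /ZV Vx].
  - move=> U V UV [Z [gZ gZA ZU]]; exists Z; split=> //.
    exact: subset_trans ZU UV.
have [h [hu F0h]] := ultraFilterLemma F0P.
pose F1 : set_system G := [set U | exists Z, [/\ algebra S Z, h Z & Z `<=` U]].
have F1F : Filter F1.
  split.
  - by exists setT; split=> //; [exact: Or32|exact: filterT].
  - move=> U V [Z [gZ hZ ZU]] [Z' [gZ' hZ' ZV]]; exists (Z `&` Z').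
    split; [exact: algebraI|exact: filterI|].
    by move=> x [/ZU Ux /ZV Vx].
  - by move=> U V UV [Z [gZ hZ ZU]]; exists Z; split=> // x /ZU/UV.
have ideal Z : algebra S Z -> h Z -> ~ algebra S (Z `&` A).
  move=> gZ hZ gZA; apply: (filter_not_empty h).
  rewrite -(setICr Z); apply: filterI => //.
  by apply: F0h; exists Z; split.
(* A [Z] in [h] missing [A] or its complement would have [Z] meet [A] in the empty set or in [Z],
   both in the algebra, against [ideal]. *)
have [|p pu [F1p pA]] := ultrafilter_meet F1 A F1F.
  move=> U [Z [gZ hZ ZU]]; apply/set0P/negP => /eqP U0.
  apply: (ideal Z gZ hZ); apply: Or31; apply/seteqP; split=> // x [/ZU Ux Ax].
  by rewrite -U0.
have [|q qu [F1q qA]] := ultrafilter_meet F1 (~` A) F1F.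
  move=> U [Z [gZ hZ ZU]]; apply/set0P/negP => /eqP U0.
  apply: (ideal Z gZ hZ); rewrite (_ : Z `&` A = Z) //; apply: setIidl => x Zx.
  apply: contrapT => nAx; rewrite -[False]/(@set0 G x) -U0.
  by split=> //; exact: ZU.
(* Either [Z] or its complement is in [h], hence in both [p] and [q]; the complement is excluded by
   [p Z]. *)
exists p, q; split=> // Z gZ pZ; apply: F1q.
have [hZ|hZ] := in_ultra_setVsetC Z hu; first by exists Z; split.
case: (filter_not_empty p); rewrite -(setICr Z); apply: filterI => //.
by apply: F1p; exists (~` Z); split=> //; exact: algebraC.
Qed.

(** * The two implications *)

(** At a union step, [X] lives in some [A l] and so in the union, or else in every [B l]; finitely
    many tails of a ray have a common tail, so then it lives in the intersection. *)
Lemma generated_side_lives {G : graph} (S : set G -> set G -> Prop)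
    (X : set (Vhat G)) (A B : set G) :
  (forall A B, S A B -> lives_in X A \/ lives_in X B) ->
  generated S A B -> lives_in X A \/ lives_in X B.
Proof.
move=> XS; elim=> [||n {}A {}B _ IH _]; [exact: XS|by move=> ? ? _ []; auto|].
have [[l ln XA]|nA] := pselect (exists2 l, l < n & lives_in X (A l)).
  by left; apply: lives_in_sub XA => x Ax; exists l.
have XB l : l < n -> lives_in X (B l).
  by move=> ln; case: (IH l ln) => // XA; case: nA; exists l.
right; split=> [v Xv l /XB[Bv _]|w Xw r wr]; first exact: Bv.
(* For [l] at least [n] the bound is an arbitrary 0, so that [choice] applies to all [l]. *)
have tail l : exists m, l < n -> forall i, m <= i -> B l (r i).
  have [ln|] := boolP (l < n); last by exists 0.
  by have [_ /(_ w Xw r wr) [m mB]] := XB l ln; exists m.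
have [m mB] := choice tail.
exists (\max_(l < n) m l) => i mi l /= ln; apply: mB => //.
by apply: leq_trans mi; exact: (leq_bigmax (Ordinal ln)).
Qed.

Lemma distinguishing_bonds_generate {G : graph} (hG : connected_graph G)
    (M : set (set (set G))) (hbond : forall c, M c -> is_bond c) :
  (forall X Y : set (Vhat G), edge_block X -> edge_block Y ->
     X `&` Y = set0 ->
     exists2 c, M c & efficiently_distinguishes c X Y) ->
  forall (k : nat) (c : set (set G)), is_cut c -> c #= `I_k ->
    generates_cut [set b | M b /\ b #<= `I_k] c.
Proof.
move=> dist k c [A [B [AB cE]]] ck.
have BE := cut_separation_compl A B AB; subst B.
exists A, (~` A); split=> //; set S := separations_of _.
suff : algebra S A.
  case=> // AE; have [[a Aa] [b nAb] _ _] := AB; first by rewrite AE in Aa.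
  by rewrite AE in nAb; case: nAb.
apply: contrapT => /ultrafilters_agree [p [q [pu qu pA qA pq]]].
have [x xP] := ultrafilter_point p hG pu.
have [y yP] := ultrafilter_point q hG qu.
have ce : c `<=` @edges G by rewrite cE; exact: edges_between_sub.
have cfin : finite_set c by exists k.
have xA : lives_in [set x] A by apply: xP; rewrite -?cE.
have yA : lives_in [set y] (~` A).
  by apply: yP; rewrite // edges_betweenC setCK -cE.
have [C Cc xC] := point_lives c x ce cfin.
have [D Dc yD] := point_lives c y ce cfin.
have CD : C <> D.
  rewrite cE in Cc Dc.
  move=> CeD; have [v [Cv Av]] := lives_in_meet _ _ _ xC xA.
  have [w [Dw nAw]] := lives_in_meet _ _ _ yD yA; apply: nAw.
  by apply: (component_sub_side A _ C v AB Cc Cv Av); rewrite CeD.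
(* With index [k.+1], the [k] edges of [c] are too few to split either block. *)
pose X := [set z | inseparable (Some k.+1) x z].
pose Y := [set z | inseparable (Some k.+1) y z].
have ck1 : fewer_than c (Some k.+1) by exists k.
have XC : lives_in X C by exact: block_lives ce ck1 Cc xC.
have YD : lives_in Y D by exact: block_lives ce ck1 Dc yD.
have cXY : distinguishes c X Y by split=> //; exists C, D.
have XY0 : X `&` Y = set0.
  apply/seteqP; split=> // z [Xz Yz]; apply: CD.
  exact: lives_in_component_eq Cc Dc (lives_in_set1 _ _ _ Xz XC)
    (lives_in_set1 _ _ _ Yz YD).
have Xb : edge_block X by exists (Some k.+1), x.
have Yb : edge_block Y by exists (Some k.+1), y.
(* Efficiency, compared with [c], bounds the size of [b] by [k]; its sides thus lie in the
   algebra. *)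
have [b Mb [bXY beff]] := dist X Y Xb Yb XY0.
have bk : b #<= `I_k by rewrite -(card_le_eqr ck); exact: beff.
have [A1 [B1 [AB1 bE _ _]]] := hbond b Mb.
have bfin : finite_set b by apply: card_le_finite bk _; exists k.
have Xx : X x by exact: inseparable_refl.
have Yy : Y y by exact: inseparable_refl.
(* Since [x] lives in [U], [p] contains [U], and so does [q]; then [y] would live in [U] as well as
   in its complement. *)
have absurd U V : cut_separation U V -> b = edges_between U V ->
    lives_in X U -> lives_in Y V -> False.
  move=> UV bUV XU YV; have VE := cut_separation_compl U V UV; subst V.
  have xU := lives_in_set1 _ _ _ Xx XU; have yV := lives_in_set1 _ _ _ Yy YV.
  have pU : p U.
    have [//|pnU] := in_ultra_setVsetC U pu.
    have xnU : lives_in [set x] (~` U).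
      by apply: xP; rewrite // setCK edges_betweenC -bUV.
    by have [v [Uv nUv]] := lives_in_meet _ _ _ xU xnU.
  have qU : q U.
    by apply: pq pU; apply: Or33; apply: gen_mem; split=> //; rewrite -bUV.
  have yU : lives_in [set y] U by apply: yP; rewrite -?bUV.
  by have [v [Uv nUv]] := lives_in_meet _ _ _ yU yV.
have := hbond b Mb; rewrite bE => /(bond_distinguishes A1 B1 X Y hG)/(_ AB1) bd.
move: bXY; rewrite bE => /bd [] [] XU YV.
  exact: absurd AB1 bE XU YV.
by apply: absurd XU YV; [exact: cut_separationC|rewrite edges_betweenC].
Qed.

(** As [k] is the smaller index, fewer than [k] edges split neither block, so an edge set of that
    size separating [x] from [y] distinguishes the blocks. *)
Lemma generating_bonds_distinguish {G : graph} (hG : connected_graph G)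
    (M : set (set (set G)))
    (hbond : forall c, M c -> is_bond c) k l (x y : Vhat G) :
  (forall (k : nat) (c : set (set G)), is_cut c -> c #= `I_k ->
    generates_cut [set b | M b /\ b #<= `I_k] c) ->
  (forall F : set (set G), fewer_than F k -> fewer_than F l) ->
  ~ inseparable k x y ->
  exists2 c, M c & efficiently_distinguishes c
    [set z | inseparable k x z] [set z | inseparable l y z].
Proof.
move=> gen kl nxy; set X := [set z | _]; set Y := [set z | _].
have [F0 F0k [F0e [C0 [D0 [C0c D0c CD0 xC0 yD0]]]]] :
    exists2 F, fewer_than F k & separates F x y.
  by apply: contrapT => nF; apply: nxy => F Fk Fxy; apply: nF; exists F.
have F0XY : distinguishes F0 X Y.
  split=> //; exists C0, D0; split=> //.
    exact: block_lives F0e F0k C0c xC0.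
  exact: block_lives F0e (kl _ F0k) D0c yD0.
have [m0 F0m0] := fewer_than_finite _ _ F0k.
have exm : exists m, `[< exists2 F, F #= `I_m & distinguishes F X Y >].
  by exists m0; apply/asboolP; exists F0.
have [m /asboolP[F Fm [Fe [C [D [Cc Dc CD XC YD]]]]] m_min] := ex_minnP exm.
have small (b : set (set G)) : b #<= `I_m -> fewer_than b k.
  move=> bm; apply: fewer_than_card_le F0k; rewrite (card_le_eqr F0m0).
  apply: card_le_trans bm _; rewrite card_le_II; apply: m_min.
  by apply/asboolP; exists F0.
have Xx : X x by exact: inseparable_refl.
have Yy : Y y by exact: inseparable_refl.
have xC := lives_in_set1 _ _ _ Xx XC; have yD := lives_in_set1 _ _ _ Yy YD.
have CD0' v : C v -> D v -> False.
  move=> Cv Dv; apply: CD.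
  exact: (component_eq _ _ _ _ v (del_edges_sym F) Cc Dc Cv Dv).
(* The edges leaving the component [C] form a cut inside the minimum set [F], to which generation is
   applied. *)
have cutC : cut_separation C (~` C).
  apply: cut_separationP; first exact: component_nonempty Cc.
  move=> CT; have [v Dv] := component_nonempty _ _ Dc.
  by apply: (CD0' v) => //; rewrite CT.
have CF : edges_between C (~` C) `<=` F.
  move=> _ [u [v [Cu nCv uv ->]]]; apply: contrapT => nF; apply: nCv.
  exact: (component_closed F C u v).
have Cm : edges_between C (~` C) #<= `I_m.
  by rewrite -(card_le_eqr Fm); exact: subset_card_le.
have [n Cn] : finite_set (edges_between C (~` C)).
  by apply: card_le_finite Cm _; exists m.
have nm : n <= m by rewrite -card_le_II -(card_le_eql Cn).
have [|U [V [UV CUV gUV]]] := gen n (edges_between C (~` C)) _ Cn.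
  by exists C, (~` C).
(* A generator with the blocks on different sides is efficient, its size being at most [n <= m] with
   [m] least possible. *)
have [[A [B [[AB [Mb bn]] XA YB]]]|nAB] := pselect (exists A B,
    [/\ separations_of [set b | M b /\ b #<= `I_n] A B, lives_in X A &
      lives_in Y B]).
  exists (edges_between A B) => //; split.
    by apply/bond_distinguishes => //; [exact: hbond|left].
  move=> F' F'XY; apply: card_le_trans bn _.
  have [[m' F'm']|/infiniteP infF'] := pselect (finite_set F'); last first.
    by apply: card_le_trans infF'; exact: subset_card_le.
  rewrite (card_le_eqr F'm') card_le_II; apply: leq_trans nm _.
  by apply: m_min; apply/asboolP; exists F'.
(* Otherwise both blocks live on the same side of each generator, hence of the generated cut; but
   its sides are [C], where [X] lives, and the complement, where [Y] lives. *)
have gen_lives : lives_in (X `|` Y) U \/ lives_in (X `|` Y) V.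
  apply: generated_side_lives gUV => A B [AB [Mb bn]].
  have be := edges_between_sub A B.
  have bk : fewer_than (edges_between A B) k.
    by apply: small; apply: card_le_trans bn _; rewrite card_le_II.
  have side j z : fewer_than (edges_between A B) j ->
      lives_in [set z' | inseparable j z z'] A \/
      lives_in [set z' | inseparable j z z'] B.
    move=> bj.
    have [E Ec zE] := point_lives _ z be (fewer_than_finite _ _ bj).
    have ZE := block_lives _ _ _ _ be bj Ec zE.
    by have [EA|EB] := component_side A B E AB Ec; [left|right];
      apply: lives_in_sub ZE.
  have both Z : lives_in X Z -> lives_in Y Z -> lives_in (X `|` Y) Z.
    by move=> XZ YZ; apply: lives_in_pointwise => z [Xz|Yz];
      [exact: lives_in_set1 Xz XZ|exact: lives_in_set1 Yz YZ].
  have [XA|XB] := side k x bk; have [YA|YB] := side l y (kl _ bk).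
  - by left; exact: both.
  - by case: nAB; exists A, B.
  - case: nAB; exists B, A; split=> //; split; first exact: cut_separationC.
    by rewrite edges_betweenC.
  - by right; exact: both.
have absurd Z : Z = C \/ Z = ~` C -> lives_in (X `|` Y) Z -> False.
  case=> -> XYZ.
    have yC := lives_in_set1 _ y _ (or_intror Yy) XYZ.
    by have [v [/CD0'/[apply]]] := lives_in_meet _ _ _ yC yD.
  have xnC := lives_in_set1 _ x _ (or_introl Xx) XYZ.
  by have [v [Cv nCv]] := lives_in_meet _ _ _ xC xnC.
exfalso; case: gen_lives; apply: absurd.
  exact: cut_sides_unique hG cutC UV CUV.
apply: cut_sides_unique hG cutC (cut_separationC _ _ UV) _.
by rewrite CUV edges_betweenC.
Qed.

Theorem theorem2 (G : graph) (hG : connected_graph G)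
    (M : set (set (set G))) (hbond : forall c, M c -> is_bond c)
    (hnested : nested_set M) :
  (forall X Y : set (Vhat G), edge_block X -> edge_block Y ->
     X `&` Y = set0 ->
     exists2 c, M c & efficiently_distinguishes c X Y)
  <->
  (forall (k : nat) (c : set (set G)), is_cut c -> c #= `I_k ->
     generates_cut [set b | M b /\ b #<= `I_k] c).
Proof.
split; first exact: distinguishing_bonds_generate.
move=> gen _ _ [k [x ->]] [l [y ->]] /seteqP[XY0 _].
(* The block with the smaller index is taken first; the other order follows by symmetry. *)
have [kl|lk] := @fewer_than_total G k l.
  apply: generating_bonds_distinguish => // kxy.
  by apply: (XY0 y); split=> //; exact: inseparable_refl.
have [|c Mc cYX] := @generating_bonds_distinguish G hG M hbond l k y x gen lk.
  by move=> lyx; apply: (XY0 x); split=> //; exact: inseparable_refl.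
by exists c => //; exact: efficiently_distinguishes_sym.
Qed.
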